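(* Let $\mathcal{F} = \{123,145,167,246,257,347,356,1,2,3,4,5,6,7,\emptyset\}\subseteq 2^{[7]}$. There is no collection of closed convex sets $X_1,\dots,X_7\subseteq\mathbb{R}^2$ realizing $\mathcal{F}$. Consequently, $\mathrm{cdim}(\mathcal{F})=3$.
   Context: Codewords are written by listing elements, e.g. $123=\{1,2,3\}$. A collection $\{X_1,\dots,X_n\}$ of subsets of $\mathbb{R}^d$ realizes a code $\mathcal{C}\subseteq 2^{[n]}$ if $\mathcal{C}=\{\sigma\subseteq[n]:\exists p\in\mathbb{R}^d,\ p\in X_i\iff i\in\sigma\}$. $\mathrm{cdim}(\mathcal{C})$ is the minimum $d$ such that $\mathcal{C}$ is realized by closed convex subsets of $\mathbb{R}^d$ (or $\infty$ if none exists). *)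

(* Defs.v *)
From HB Require Import structures.
From mathcomp Require Import all_boot all_order all_algebra.
From mathcomp Require Import all_classical all_reals all_analysis.

Set Implicit Arguments.
Unset Strict Implicit.
Unset Printing Implicit Defensive.

Import numFieldNormedType.Exports.

Local Open Scope classical_set_scope.

Definition code (n : nat) := {set {set 'I_n}}.

Definition realizes (R : realType) (d n : nat)
    (X : 'I_n -> set 'rV[R]_d) (C : code n) : Prop :=
  forall s : {set 'I_n},
    s \in C <-> exists p : 'rV[R]_d, forall i : 'I_n, X i p <-> i \in s.

Definition closed_convex_realizable (R : realType) (d n : nat) (C : code n) :
    Prop :=
  exists X : 'I_n -> set 'rV[R]_d,
    [/\ forall i, closed (X i), forall i, convex_set (X i) & realizes X C].

(* [None] stands for infinity. *)
Definition cdim (R : realType) (n : nat) (C : code n) : option nat :=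
  match pselect (exists d, `[< closed_convex_realizable R d C >]) with
  | left exd => Some (ex_minn exd)
  | right _ => None
  end.

(* Codewords are listed with the labels 1, ..., n; the label k stands for the
   element of 'I_n of value k - 1. *)
Definition codeword (n : nat) (w : seq nat) : {set 'I_n} :=
  [set i : 'I_n | i.+1 \in w]%SET.

Definition fano_code : code 7 :=
  [set:: map (@codeword 7)
    [:: [:: 1; 2; 3]; [:: 1; 4; 5]; [:: 1; 6; 7]; [:: 2; 4; 6];
        [:: 2; 5; 7]; [:: 3; 4; 7]; [:: 3; 5; 6];
        [:: 1]; [:: 2]; [:: 3]; [:: 4]; [:: 5]; [:: 6]; [:: 7]; [::]]]%SET.

(* Main.v *)
(* The seven three-element words are the lines of a Fano plane; dually, we call
   them points and the labels 1, ..., 7 lines.  The points of the plane with a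
   given three-element word form a convex cell, the cells are disjoint, and two
   of the convex sets meet exactly in the cell of their common word.  Pick
   representatives in the cells, and call an edge pq blocked when it meets the
   cell of the third point on the line pq.  Two crossing edges lie in two of the
   convex sets, so the crossing point is in a cell and blocks one of them.
   Blocked edges form a matching: if pq and qr are blocked at t and u, then the
   fourth point s of the quadrangle is represented on the cevians pu and rt, the
   third diagonal point m on qs and tu, and s lies between m and the segment pr,
   which puts the cell of s inside the convex set of the line pr.
   If pq is blocked at t, then for two other points on the same side of the line
   pq the one closer to pq is in the triangle spanned by pq and the other one, x
   say, since otherwise there is a crossing that blocks a second edge at p or q;
   hence tx crosses an edge at p or q and is itself blocked.  Among any three of
   the four points off the line pq two are on the same side, so two edges at t
   are blocked, a contradiction.  So no edge is blocked and there are no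
   crossings at all; but three of five points are on the same side of any edge,
   and then there is one.  Closedness plays no role in dimension at most 2; in
   dimension 3 seven triangles realize the code. *)

Require Import Defs.
From HB Require Import structures.
From mathcomp Require Import all_boot all_order all_algebra.
From mathcomp Require Import all_classical all_reals all_analysis.
From mathcomp Require Import ring lra zify.

Set Implicit Arguments.
Unset Strict Implicit.
Unset Printing Implicit Defensive.

Import numFieldNormedType.Exports.

(** * Segments and triangles *)

Section Segments.
Import Order.TTheory GRing.Theory Num.Theory.
Local Open Scope ring_scope.
Variables (R : realType) (n : nat).
Implicit Types p q r s u v w x y z : 'rV[R]_n.

Definition segment x y : set 'rV[R]_n := fun z =>
  exists a b : R, [/\ 0 <= a, 0 <= b, a + b = 1 & z = a *: x + b *: y].

Definition segments_meet x y z w :=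
  exists u, segment x y u /\ segment z w u.

Lemma segmentC x y z : segment x y z -> segment y x z.
Proof. by move=> [a [b [? ? ? ->]]]; exists b, a; split=> //; rewrite addrC. Qed.

Lemma segment_left x y : segment x y x.
Proof. by exists 1, 0; rewrite ler01 lexx addr0 scale1r scale0r addr0. Qed.

Lemma segment_right x y : segment x y y.
Proof. exact/segmentC/segment_left. Qed.

Lemma segment_normalize x y (a b : R) : 0 <= a -> 0 <= b -> 0 < a + b ->
  segment x y ((a + b)^-1 *: (a *: x + b *: y)).
Proof.
move=> a0 b0 ab; have ab0 : a + b != 0 by rewrite gt_eqF.
exists (a / (a + b)), (b / (a + b)); split.
- by rewrite divr_ge0 // ltW.
- by rewrite divr_ge0 // ltW.
- by rewrite -mulrDl divff.
- by rewrite scalerDr !scalerA ![_^-1 * _]mulrC.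
Qed.

(** Homogeneous weights with equal totals suffice, so crossings can be exhibited without
    dividing. *)
Lemma segments_meet_weights x y z w (a b c d : R) :
  0 <= a -> 0 <= b -> 0 <= c -> 0 <= d -> 0 < a + b -> a + b = c + d ->
  a *: x + b *: y = c *: z + d *: w -> segments_meet x y z w.
Proof.
move=> a0 b0 c0 d0 ab e E; exists ((a + b)^-1 *: (a *: x + b *: y)).
split; first exact: segment_normalize.
by rewrite E e; apply: segment_normalize; rewrite -?e.
Qed.

(* The cevians pv and ru of the triangle pqr meet in s; the third cevian qs
   meets uv in c, and its extension beyond s leaves the triangle at e. *)
Lemma cevians_meet p q r u v : segment p q u -> segment q r v ->
  exists s c e, [/\ segment p v s, segment r u s, segment q s c,
                    segment u v c & segment p r e /\ segment c e s].
Proof.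
move=> [a [b [a0 b0 ab uE]]] [c [d [c0 d0 cd vE]]].
(* If both weights vanish, then [u = p] and [v = r], both cevians run along [pr], and [p] serves for
   all three points. *)
have [bc|bc] : b + c = 0 \/ 0 < b + c by lra.
  have [b00 c00] : b = 0 /\ c = 0 by split; lra.
  have [a1 d1] : a = 1 /\ d = 1 by split; lra.
  have -> : u = p by rewrite uE a1 b00 scale1r scale0r addr0.
  by exists p, p, p; split; try split;
    (exact: segment_left || exact: segment_right).
have D0 : 0 < b + c - b * c by nra.
have Dn : b + c - b * c != 0 by rewrite gt_eqF.
have bcn : b + c != 0 by rewrite gt_eqF.
(* By Ceva, the crossing has weights [a c : b c : b d], whose total is [b + c - b c]. *)
pose s := (b + c - b * c)^-1 *: ((a * c) *: p + (b * c) *: q + (b * d) *: r).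
pose m := (b + c)^-1 *: (c *: u + b *: v).
have aE : a = 1 - b by lra.
have dE : d = 1 - c by lra.
(* This identity places [s] between [m] and the point of [pr] with weights [a c : b d]. *)
have sm : (2 * (b + c - b * c)) *: s =
  (b + c) *: m + ((a * c) *: p + (b * d) *: r).
  by apply/rowP=> i; rewrite /s /m uE vE aE dE !mxE; field; rewrite bcn Dn.
have [e [pre mes]] : exists e, segment p r e /\ segment m e s.
  have ac : 0 <= a * c by rewrite mulr_ge0.
  have bd : 0 <= b * d by rewrite mulr_ge0.
  have [w0|w0] : (a * c = 0 /\ b * d = 0) \/ 0 < a * c + b * d by lra.
    exists p; split; first exact: segment_left.
    have -> : s = m; last exact: segment_left.
    have k : b + c = 2 * (b + c - b * c) by case: w0; rewrite aE dE; lra.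
    apply: (@scalerI _ _ (b + c)) => //; rewrite {1}k sm.
    by case: w0 => -> ->; rewrite !scale0r !addr0.
  exists ((a * c + b * d)^-1 *: ((a * c) *: p + (b * d) *: r)); split.
    exact: segment_normalize.
  exists ((b + c) / (2 * (b + c - b * c))),
    ((a * c + b * d) / (2 * (b + c - b * c))).
  split; try by rewrite divr_ge0 //; lra.
    by rewrite aE dE; field.
  apply: (@scalerI _ _ (2 * (b + c - b * c))); first by rewrite gt_eqF //; lra.
  rewrite sm; apply/rowP=> i; rewrite !mxE; field.
  by rewrite Dn gt_eqF.
exists s, m, e; split=> //.
- exists (a * c / (b + c - b * c)), (b / (b + c - b * c)).
  split; try by rewrite divr_ge0 ?mulr_ge0 ?(ltW D0).
    by rewrite aE; field.
  by apply/rowP=> i; rewrite /s vE !mxE; field.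
- exists (b * d / (b + c - b * c)), (c / (b + c - b * c)).
  split; try by rewrite divr_ge0 ?mulr_ge0 ?(ltW D0).
    by rewrite dE; field.
  by apply/rowP=> i; rewrite /s uE !mxE; field.
- exists (b * c / (b + c)), ((b + c - b * c) / (b + c)).
  split; try by rewrite divr_ge0 ?mulr_ge0 ?(ltW D0) ?(ltW bc).
    by field.
  by apply/rowP=> i; rewrite /s /m uE vE aE dE !mxE; field; rewrite bcn Dn.
- by rewrite /m [b + c]addrC; apply: segment_normalize => //; rewrite addrC.
Qed.

(* The triangle pqx without its side pq. *)
Definition below p q x : set 'rV[R]_n := fun y => exists a b c : R,
  [/\ 0 <= a, 0 <= b, 0 < c, a + b + c = 1 & y = a *: p + b *: q + c *: x].

(** The line [xy] cuts the triangle [pqy] through its apex [y]. The segment from [x] to [z] enters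
    this triangle through [qy] or [py], depending on the side of that line on which [z] lies; the
    sign of [a' b - b' a] decides. *)
Lemma below_chain_meet p q x y z : below p q x y -> below p q y z ->
  segments_meet x z p y \/ segments_meet x z q y.
Proof.
move=> [a [b [c [a0 b0 c0 abc yE]]]] [a' [b' [c' [a'0 b'0 c'0 abc' zE]]]].
have ac' : 0 <= c * a' by rewrite mulr_ge0 // ltW.
have bc' : 0 <= c * b' by rewrite mulr_ge0 // ltW.
have cc' : 0 < c * c' by rewrite mulr_gt0.
have xE : c *: x = y - a *: p - b *: q.
  by rewrite yE; apply/rowP=> i; rewrite !mxE; ring.
case: (leP (a' * b) (b' * a)) => h.
  have [w0|w0] : (a = 0 /\ c * a' = 0) \/ 0 < c * a' + a by lra.
    right; exists z; split; first exact: segment_right.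
    have a'00 : a' = 0 by case: w0 => _ /eqP; rewrite mulf_eq0 gt_eqF // => /eqP.
    exists b', c'; split; [exact: b'0|exact: ltW|lra|].
    by rewrite zE a'00 scale0r add0r.
  right; apply: (@segments_meet_weights _ _ _ _
    (c * a') a (a * b' - a' * b) (a * c' + a')) => //.
  - lra.
  - by rewrite addr_ge0 // mulr_ge0 // ltW.
  - have -> : c = 1 - a - b by lra.
    have -> : c' = 1 - a' - b' by lra.
    by ring.
  - rewrite zE [c * a']mulrC -scalerA xE.
    by apply/rowP=> i; rewrite !mxE; ring.
have [w0|w0] : (b = 0 /\ c * b' = 0) \/ 0 < c * b' + b by lra.
  left; exists z; split; first exact: segment_right.
  have b'00 : b' = 0 by case: w0 => _ /eqP; rewrite mulf_eq0 gt_eqF // => /eqP.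
  exists a', c'; split; [exact: a'0|exact: ltW|lra|].
  by rewrite zE b'00 scale0r addr0.
left; apply: (@segments_meet_weights _ _ _ _
  (c * b') b (b * a' - b' * a) (b * c' + b')) => //.
- lra.
- by rewrite addr_ge0 // mulr_ge0 // ltW.
- have -> : c = 1 - a - b by lra.
  have -> : c' = 1 - a' - b' by lra.
  by ring.
- rewrite zE [c * b']mulrC -scalerA xE.
  by apply/rowP=> i; rewrite !mxE; ring.
Qed.

(** The segment [wy] splits the triangle [pqy] in two; if [z] is in the part at [p], then [qz]
    crosses [wy], and symmetrically. *)
Lemma below_base_meet p q y z w : below p q y z -> segment p q w ->
  segments_meet w y p z \/ segments_meet w y q z.
Proof.
move=> [a' [b' [c' [a'0 b'0 c'0 abc' zE]]]] [a [b [a0 b0 ab wE]]].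
have ac' : 0 <= a * c' by rewrite mulr_ge0 // ltW.
have bc' : 0 <= b * c' by rewrite mulr_ge0 // ltW.
case: (leP (a * b') (b * a')) => h.
  have [w0|w0] : (a' = 0 /\ a * c' = 0) \/ 0 < a' + a * c' by lra.
    have a00 : a = 0.
      by case: w0 => _ /eqP; rewrite mulf_eq0 (gt_eqF c'0) orbF => /eqP.
    right; exists q; split; last exact: segment_left.
    have -> : w = q; last exact: segment_left.
    by rewrite wE a00 (_ : b = 1) ?scale0r ?scale1r ?add0r //; lra.
  right; apply: (@segments_meet_weights _ _ _ _
    a' (a * c') (b * a' - a * b') a) => //.
  - lra.
  - have -> : c' = 1 - a' - b' by lra.
    have -> : b = 1 - a by lra.
    by ring.
  - by rewrite zE wE; apply/rowP=> i; rewrite !mxE;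
      rewrite (_ : b = 1 - a); [ring|lra].
have [w0|w0] : (b' = 0 /\ b * c' = 0) \/ 0 < b' + b * c' by lra.
  have b00 : b = 0.
    by case: w0 => _ /eqP; rewrite mulf_eq0 (gt_eqF c'0) orbF => /eqP.
  left; exists p; split; last exact: segment_left.
  have -> : w = p; last exact: segment_left.
  by rewrite wE b00 (_ : a = 1) ?scale0r ?scale1r ?addr0 //; lra.
left; apply: (@segments_meet_weights _ _ _ _
  b' (b * c') (a * b' - b * a') b) => //.
- lra.
- have -> : c' = 1 - a' - b' by lra.
  have -> : a = 1 - b by lra.
  by ring.
- by rewrite zE wE; apply/rowP=> i; rewrite !mxE;
    rewrite (_ : a = 1 - b); [ring|lra].
Qed.

End Segments.

(** * Signed areas and barycentric coordinates in the plane *)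

Section Heights.
Import Order.TTheory GRing.Theory Num.Theory.
Local Open Scope ring_scope.
Variable R : realType.
Implicit Types p q x y : 'rV[R]_2.

(* Twice the signed area of pqx. *)
Definition height p q x : R :=
  (q 0 0 - p 0 0) * (x 0 1 - p 0 1) - (q 0 1 - p 0 1) * (x 0 0 - p 0 0).

Lemma rV2P x y : x 0 0 = y 0 0 -> x 0 1 = y 0 1 -> x = y.
Proof.
move=> e0 e1; apply/rowP=> -[[|[|//]] i].
  by rewrite (_ : Ordinal i = 0) //; apply: val_inj.
by rewrite (_ : Ordinal i = 1) //; apply: val_inj.
Qed.

Lemma barycentric p q x y : height p q x != 0 ->
  let b := height p y x / height p q x in
  let c := height p q y / height p q x in
  y = (1 - b - c) *: p + b *: q + c *: x.
Proof. by move=> h0 b c; apply: rV2P; rewrite !mxE /b /c /height; field. Qed.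

(** The barycentric coordinate of [y] at [x] is in (0, 1], so at most one of the other two is
    negative. If one is, [y] lies beyond the opposite side, and the segment to [y] from the
    corresponding vertex crosses that side. *)
Lemma nested_or_cross p q x y : height p q x != 0 ->
  0 < height p q y / height p q x <= 1 ->
  [\/ below p q x y, segments_meet p y q x | segments_meet q y p x].
Proof.
move=> h0; set c := _ / _ => /andP[c0 c1].
have := barycentric y h0; rewrite -/c /=; set b := _ / _ => yE.
case: (ltP b 0) => b0.
  constructor 3; apply: (@segments_meet_weights _ _ _ _ _ _
    (- b) 1 (1 - b - c) c); [lra|lra|lra|lra|lra|lra|].
  by rewrite {1}yE; apply/rowP=> i; rewrite !mxE; ring.
case: (ltP (1 - b - c) 0) => a0.
  constructor 2; apply: (@segments_meet_weights _ _ _ _ _ _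
    (b + c - 1) 1 b c); [lra|lra|lra|lra|lra|lra|].
  by rewrite {1}yE; apply/rowP=> i; rewrite !mxE; ring.
by constructor 1; exists (1 - b - c), b, c; split=> //; ring.
Qed.

Lemma collinear_segment p q x : p <> q -> height p q x = 0 ->
  [\/ segment p q x, segment q x p | segment p x q].
Proof.
move=> pq h0; have [t xE] : exists t, x = (1 - t) *: p + t *: q.
  have [e0|n0] := eqVneq (q 0 0) (p 0 0).
    have n1 : q 0 1 - p 0 1 != 0.
      by rewrite subr_eq0; apply/eqP => e1; apply/pq/rV2P.
    exists ((x 0 1 - p 0 1) / (q 0 1 - p 0 1)); apply: rV2P; rewrite !mxE.
      move: h0; rewrite /height e0 subrr mul0r sub0r => /eqP.
      rewrite oppr_eq0 mulf_eq0 (negPf n1) /= subr_eq0 => /eqP ->.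
      by field.
    by field.
  have n1 : q 0 0 - p 0 0 != 0 by rewrite subr_eq0.
  exists ((x 0 0 - p 0 0) / (q 0 0 - p 0 0)); apply: rV2P; rewrite !mxE.
    by field.
  apply: (mulfI n1); move: h0; rewrite /height => /eqP.
  rewrite subr_eq0 => /eqP h.
  have -> : (q 0 0 - p 0 0) * x 0 1 =
    (q 0 1 - p 0 1) * (x 0 0 - p 0 0) + (q 0 0 - p 0 0) * p 0 1.
    by rewrite -h; ring.
  by field.
case: (ltP t 0) => t0.
  constructor 2; exists (- t / (1 - t)), (1 / (1 - t)).
  have t1 : 1 - t != 0 by rewrite gt_eqF //; lra.
  split; first by rewrite divr_ge0 //; lra.
  - by rewrite divr_ge0 //; lra.
  - by field.
  - by rewrite xE; apply/rowP=> i; rewrite !mxE; field.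
case: (leP t 1) => t1.
  by constructor 1; exists (1 - t), t; split=> //; lra.
have tn : t != 0 by rewrite gt_eqF //; lra.
constructor 3; exists ((t - 1) / t), (1 / t); split.
- by rewrite divr_ge0 //; lra.
- by rewrite divr_ge0 //; lra.
- by field.
- by rewrite xE; apply/rowP=> i; rewrite !mxE; field.
Qed.

Lemma same_sign_ratio (a b : R) : 0 < a * b ->
  0 < b / a <= 1 \/ 0 < a / b <= 1.
Proof.
move=> ab; have ba0 : 0 < b / a.
  have a0 : a != 0 by apply: contraTneq ab => ->; rewrite mul0r ltxx.
  have -> : b / a = (a * b) / a ^+ 2 by field.
  by rewrite divr_gt0 // exprn_even_gt0.
rewrite ba0; case: (leP (b / a) 1) => [|h]; first by left.
right; rewrite -[a / b]invf_div invr_gt0 ba0 /=.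
by rewrite invf_le1 // ltW.
Qed.

Lemma three_signs (a b c : R) : a != 0 -> b != 0 -> c != 0 ->
  [\/ 0 < a * b, 0 < b * c | 0 < a * c].
Proof.
move=> a0 b0 c0.
have /lt_total/orP[ab|ab] := mulf_neq0 a0 b0; last by constructor 1.
have /lt_total/orP[bc|bc] := mulf_neq0 b0 c0; last by constructor 2.
constructor 3; have : 0 < b ^+ 2 * (a * c).
  have -> : b ^+ 2 * (a * c) = (a * b) * (b * c) by ring.
  by rewrite nmulr_rgt0.
by rewrite pmulr_rgt0 // exprn_even_gt0.
Qed.

End Heights.

(** * The Fano plane *)

Inductive fano := F1 | F2 | F3 | F4 | F5 | F6 | F7.

Definition fano_bits (p : fano) : bool * bool * bool :=
  match p with
  | F1 => (false, false, true) | F2 => (false, true, false)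
  | F3 => (false, true, true) | F4 => (true, false, false)
  | F5 => (true, false, true) | F6 => (true, true, false)
  | F7 => (true, true, true)
  end.

(* Junk value [F1] at the zero vector. *)
Definition fano_of_bits (b : bool * bool * bool) : fano :=
  match b with
  | (false, true, false) => F2 | (false, true, true) => F3
  | (true, false, false) => F4 | (true, false, true) => F5
  | (true, true, false) => F6 | (true, true, true) => F7
  | _ => F1
  end.

Lemma fano_bitsK : cancel fano_bits fano_of_bits.
Proof. by case. Qed.

HB.instance Definition _ := Equality.copy fano (can_type fano_bitsK).

(* Points and lines of the Fano plane are both coded by the nonzero vectors of
   F_2^3, with incidence given by the dot product; hence the line through two
   points, and the meet of two lines, are both given by the cross product. *)
Definition incident (p l : fano) : bool :=
  let: (a1, a2, a3) := fano_bits p in let: (b1, b2, b3) := fano_bits l in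
  ~~ ((a1 && b1) (+) (a2 && b2) (+) (a3 && b3)).

Definition join (p q : fano) : fano :=
  let: (a1, a2, a3) := fano_bits p in let: (b1, b2, b3) := fano_bits q in
  fano_of_bits ((a2 && b3) (+) (a3 && b2), (a3 && b1) (+) (a1 && b3),
                (a1 && b2) (+) (a2 && b1)).

Definition third (p q : fano) : fano :=
  let: (a1, a2, a3) := fano_bits p in let: (b1, b2, b3) := fano_bits q in
  fano_of_bits (a1 (+) b1, a2 (+) b2, a3 (+) b3).

Definition triangle (p q r : fano) :=
  [&& p != q, q != r, p != r & r != third p q].

Lemma joinl p q : p != q -> incident p (join p q).
Proof. by case: p; case: q. Qed.
Lemma joinr p q : p != q -> incident q (join p q).
Proof. by case: p; case: q. Qed.
Lemma thirdC p q : third p q = third q p.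
Proof. by case: p; case: q. Qed.

Lemma incident_inj p q : (forall l, incident p l = incident q l) -> p = q.
Proof.
move=> h; move: (h F1) (h F2) (h F3) (h F4) (h F5) (h F6) (h F7).
by case: p {h}; case: q.
Qed.

(** A line has only three points, so the two lines differ. Their meet cannot belong to both of the
    disjoint pairs, hence it is the third point of one line. *)
Lemma join_meet p q r s : uniq [:: p; q; r; s] ->
  [&& join p q != join r s &
   let n := join (join p q) (join r s) in (n == third p q) || (n == third r s)].
Proof. by case: p; case: q; case: r; case: s. Qed.

(* [s] is the fourth point of the quadrangle on [p], [q], [r], and [m] its
   diagonal point other than [t] and [u]. *)
Lemma quadrangle p q r : triangle p q r ->
  let t := third p q in let u := third q r in
  let s := join (join p u) (join r t) in
  let m := join (join q s) (join t u) in
  [/\ [&& p != u, r != t, q != s & t != u], join p u != join r t,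
      join q s != join t u, incident m (join p r) & ~~ incident s (join p r)].
Proof. by case: p; case: q; case: r. Qed.

Lemma triangle_exists p q : p != q -> exists r, triangle p q r.
Proof.
by case: p; case: q => // _; do [exists F1; reflexivity | exists F2; reflexivity
  | exists F4; reflexivity | exists F7; reflexivity].
Qed.

(** * Dimension two *)

Section Plane.
Import Order.TTheory GRing.Theory Num.Theory.
Local Open Scope ring_scope.
Variables (R : realType) (X : fano -> set 'rV[R]_2).
Implicit Types P Q S T U Z : 'rV[R]_2.

Definition cell (n : fano) : set 'rV[R]_2 := fun Z =>
  forall l, X l Z <-> incident n l.

Hypothesis X_segment : forall l P Q Z, X l P -> X l Q -> segment P Q Z -> X l Z.
Hypothesis X_meet : forall l m Z, l != m -> X l Z -> X m Z -> exists n, cell n Z.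

Lemma cell_inj n m Z : cell n Z -> cell m Z -> n = m.
Proof.
move=> cn cm; apply: incident_inj => l.
by apply/idP/idP => h; [apply/cm/cn | apply/cn/cm].
Qed.

Lemma meet_cell l m Z : l != m -> X l Z -> X m Z -> cell (join l m) Z.
Proof.
move=> lm Xl Xm; have [n cn] := X_meet lm Xl Xm.
suff -> : join l m = n by [].
move/cn: Xl; move/cn: Xm; clear -lm.
by case: l lm; case: m => // _; case: n.
Qed.

Lemma cell_segment n P Q Z : cell n P -> cell n Q -> segment P Q Z -> cell n Z.
Proof.
move=> cP cQ PQZ.
have XZ l : incident n l -> X l Z.
  by move=> i; apply: X_segment PQZ; [apply/cP | apply/cQ].
(* Membership in two lines through [n] already forces membership in the cell of [n]; any two will
   do. *)
have [l1 [l2 [l12 i1 i2 ->]]] :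
    exists l1, exists l2, [/\ l1 != l2, incident n l1, incident n l2
      & n = join l1 l2].
  by case: (n); [exists F2, F4 | exists F1, F4 | exists F3, F4 | exists F1, F2
    | exists F2, F5 | exists F1, F6 | exists F3, F6].
by apply: meet_cell => //; apply: XZ.
Qed.

Lemma join_segment p q P Q Z : p != q -> cell p P -> cell q Q ->
  segment P Q Z -> X (join p q) Z.
Proof.
move=> pq cP cQ; apply: X_segment; [apply/cP; exact: joinl|].
by apply/cQ; exact: joinr.
Qed.

(* [P] and [Q] are meant to lie in the cells of [p] and [q]. *)
Definition blocked p q P Q := exists2 Z, segment P Q Z & cell (third p q) Z.

Lemma blockedC p q P Q : blocked p q P Q -> blocked q p Q P.
Proof. by case=> Z /segmentC PQZ cZ; exists Z => //; rewrite thirdC. Qed.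

Lemma meet_blocked p q r s P Q S T : uniq [:: p; q; r; s] ->
  cell p P -> cell q Q -> cell r S -> cell s T -> segments_meet P Q S T ->
  blocked p q P Q \/ blocked r s S T.
Proof.
move=> u cP cQ cS cT [Z [PQZ STZ]]; have /andP[lm] := join_meet u.
have pq : p != q by move: u; rewrite /= !inE !negb_or; case: (p != q).
have rs : r != s by move: u; rewrite /= !inE !negb_or andbT => /and3P[].
have cZ := meet_cell lm (join_segment pq cP cQ PQZ) (join_segment rs cS cT STZ).
by case/orP=> /eqP e; [left | right]; exists Z; rewrite -?e.
Qed.

Lemma blocked_matching p q r P Q S : p != q -> q != r -> p != r ->
  cell p P -> cell q Q -> cell r S ->
  blocked p q P Q -> blocked q r Q S -> False.
Proof.
move=> pq qr pr cP cQ cS [T PQT cT] [U QSU cU].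
have [Z [W [E [PUZ STZ QZW TUW [PSE WEZ]]]]] := cevians_meet PQT QSU.
(* In the collinear case [T] is in the cell of [r] and [U] in that of [p], so the crossing [Z] of
   the cevians would be in both cells. *)
have [rE|nr] := eqVneq r (third p q).
  have pE : p = third q r by rewrite rE; case: (p) pq; case: (q).
  rewrite -rE in cT; rewrite -pE in cU.
  move: (cell_inj (cell_segment cP cU PUZ) (cell_segment cS cT STZ)) => e.
  by rewrite e eqxx in pr.
have pqr : triangle p q r by rewrite /triangle pq qr pr nr.
have [/and4P[pu rt qs tu] l1 l2 im sN] := quadrangle pqr.
(* [Z] is in the cell of the fourth point and [W] in that of the diagonal point. [W] and [E] are
   both in the set of the line [pr], hence so is [Z]. *)
have cZ := meet_cell l1 (join_segment pu cP cU PUZ) (join_segment rt cS cT STZ).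
have cW := meet_cell l2 (join_segment qs cQ cZ QZW) (join_segment tu cT cU TUW).
have XE := join_segment pr cP cS PSE.
have /cZ iZ : X (join p r) Z by apply: X_segment WEZ => //; apply/cW.
by rewrite iZ in sN.
Qed.

(** Otherwise one of the three representatives would be on the segment of the other two, hence in
    the set of a line not incident with it. *)
Lemma height_neq0 p q r P Q S : triangle p q r ->
  cell p P -> cell q Q -> cell r S -> height P Q S != 0.
Proof.
move=> /and4P[pq qr pr nr] cP cQ cS.
have PQ : P <> Q.
  by move=> e; rewrite e in cP; rewrite (cell_inj cP cQ) eqxx in pq.
apply/eqP=> /(collinear_segment PQ)[h|h|h].
- have /cS := join_segment pq cP cQ h.
  by move: pq qr pr nr; case: (p); case: (q); case: (r).
- have /cP := join_segment qr cQ cS h.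
  by move: pq qr pr nr; case: (p); case: (q); case: (r).
- have /cQ := join_segment pr cP cS h.
  by move: pq qr pr nr; case: (p); case: (q); case: (r).
Qed.

Lemma blocked_apex p q x y P Q T U Z : triangle p q x -> triangle p q y ->
  x != y -> cell p P -> cell q Q -> cell x U -> cell y Z ->
  segment P Q T -> cell (third p q) T ->
  0 < height P Q Z / height P Q U <= 1 -> blocked (third p q) x T U.
Proof.
move=> tx ty xy cP cQ cU cZ PQT cT h.
have bPQ : blocked p q P Q by exists T.
have [pq qx px nx] := and4P tx; have [_ qy py ny] := and4P ty.
have qp : q != p by rewrite eq_sym.
have yx : y != x by rewrite eq_sym.
(* The matching already pairs [p] with [q], so no other edge at [p] or [q] is blocked. *)
have nP r S : r != p -> r != q -> cell r S -> ~ blocked p r P S.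
  move=> rp rq cS b; rewrite eq_sym in rp; rewrite eq_sym in rq.
  exact: blocked_matching qp rp rq cQ cP cS (blockedC bPQ) b.
have nQ r S : r != p -> r != q -> cell r S -> ~ blocked q r Q S.
  move=> rp rq cS b; rewrite eq_sym in rp; rewrite eq_sym in rq.
  exact: blocked_matching pq rq rp cP cQ cS bPQ b.
have [B|M|M] := nested_or_cross (height_neq0 tx cP cQ cU) h.
(* With [Z] in the triangle [PQU], the segment [TU] crosses [PZ] or [QZ]; these are not blocked, so
   [TU] is. *)
- have [M|M] := below_base_meet B PQT.
  + have u : uniq [:: third p q; x; p; y].
      by move: tx ty xy; case: (p); case: (q); case: (x); case: (y).
    have [//|/nP] := meet_blocked u cT cU cP cZ M.
    by case; rewrite // eq_sym.
  + have u : uniq [:: third p q; x; q; y].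
      by move: tx ty xy; case: (p); case: (q); case: (x); case: (y).
    have [//|/nQ] := meet_blocked u cT cU cQ cZ M.
    by case; rewrite // eq_sym.
(* Otherwise an edge at [p] crosses an edge at [q], and neither can be blocked. *)
- have u : uniq [:: p; y; q; x].
    by move: tx ty xy; case: (p); case: (q); case: (x); case: (y).
  have [/nP|/nQ] := meet_blocked u cP cZ cQ cU M.
  + by case; rewrite // eq_sym.
  + by case; rewrite // eq_sym.
- have u : uniq [:: q; y; p; x].
    by move: tx ty xy; case: (p); case: (q); case: (x); case: (y).
  have [/nQ|/nP] := meet_blocked u cQ cZ cP cU M.
  + by case; rewrite // eq_sym.
  + by case; rewrite // eq_sym.
Qed.

Lemma blocked_apex_of_three p q x y z P Q T U Z W :
  triangle p q x -> triangle p q y -> triangle p q z -> uniq [:: x; y; z] ->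
  cell p P -> cell q Q -> cell x U -> cell y Z -> cell z W ->
  segment P Q T -> cell (third p q) T ->
  [\/ blocked (third p q) x T U, blocked (third p q) y T Z
    | blocked (third p q) z T W].
Proof.
move=> tx ty tz u cP cQ cU cZ cW PQT cT.
have [xy yz xz] : [/\ x != y, y != z & x != z].
  by move: u; rewrite /= !inE negb_or andbT => /andP[/andP[]].
have [h|h|h] := three_signs (height_neq0 tx cP cQ cU) (height_neq0 ty cP cQ cZ)
  (height_neq0 tz cP cQ cW).
- have [k|k] := same_sign_ratio h.
  + constructor 1.
    exact: (blocked_apex tx ty xy cP cQ cU cZ PQT cT k).
  + constructor 2; rewrite eq_sym in xy.
    exact: (blocked_apex ty tx xy cP cQ cZ cU PQT cT k).
- have [k|k] := same_sign_ratio h.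
  + constructor 2.
    exact: (blocked_apex ty tz yz cP cQ cZ cW PQT cT k).
  + constructor 3; rewrite eq_sym in yz.
    exact: (blocked_apex tz ty yz cP cQ cW cZ PQT cT k).
- have [k|k] := same_sign_ratio h.
  + constructor 1.
    exact: (blocked_apex tx tz xz cP cQ cU cW PQT cT k).
  + constructor 3; rewrite eq_sym in xz.
    exact: (blocked_apex tz tx xz cP cQ cW cU PQT cT k).
Qed.

Hypothesis cell_neq0 : forall n, exists Z, cell n Z.

Lemma not_blocked p q P Q : p != q -> cell p P -> cell q Q -> ~ blocked p q P Q.
Proof.
move=> pq cP cQ [T PQT cT]; have [r t1] := triangle_exists pq.
set t := third p q in cT.
(* As vectors over F_2, the four points off the line [pq] are [r], [t + r], [p + r] and [q + r]. *)
have [A cA] := cell_neq0 r.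
have [B cB] := cell_neq0 (third t r).
have [C cC] := cell_neq0 (third p r).
have [D cD] := cell_neq0 (third q r).
have [t2 t3 t4 u] : [/\ triangle p q (third t r), triangle p q (third p r),
    triangle p q (third q r) &
    uniq [:: t; r; third t r; third p r; third q r]].
  by rewrite /t; move: t1; case: (p); case: (q); case: (r).
have no x y U Z : uniq [:: t; x; y] -> cell x U -> cell y Z ->
    blocked t x T U -> blocked t y T Z -> False.
  rewrite /= !inE negb_or andbT => /andP[/andP[tx ty] xy] cU cZ bx by_.
  have xt : x != t by rewrite eq_sym.
  exact: blocked_matching xt ty xy cU cT cZ (blockedC bx) by_.
move: u; rewrite /= !inE !negb_or !andbT.
move=> /and4P[/and4P[u1 u2 u3 u4] /and3P[u5 u6 u7] /andP[u8 u9] u10].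
have three x y z U Z W (tx : triangle p q x) (ty : triangle p q y)
    (tz : triangle p q z) (u : uniq [:: x; y; z]) (cU : cell x U) (cZ : cell y Z)
    (cW : cell z W) := @blocked_apex_of_three p q x y z
  P Q T U Z W tx ty tz u cP cQ cU cZ cW PQT cT.
have ub (x y z : fano) : x != y -> x != z -> y != z -> uniq [:: x; y; z].
  by move=> xy xz yz; rewrite /= !inE negb_or xy xz yz.
have [b|b|b] := three _ _ _ _ _ _ t1 t2 t3 (ub _ _ _ u5 u6 u8) cA cB cC.
- have [b'|b'|b'] := three _ _ _ _ _ _ t2 t3 t4 (ub _ _ _ u8 u9 u10) cB cC cD.
  + by apply: no cA cB b b'; apply: ub.
  + by apply: no cA cC b b'; apply: ub.
  + by apply: no cA cD b b'; apply: ub.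
- have [b'|b'|b'] := three _ _ _ _ _ _ t1 t3 t4 (ub _ _ _ u6 u7 u10) cA cC cD.
  + by apply: no cA cB b' b; apply: ub.
  + by apply: no cB cC b b'; apply: ub.
  + by apply: no cB cD b b'; apply: ub.
- have [b'|b'|b'] := three _ _ _ _ _ _ t1 t2 t4 (ub _ _ _ u5 u7 u9) cA cB cD.
  + by apply: no cA cC b' b; apply: ub.
  + by apply: no cB cC b' b; apply: ub.
  + by apply: no cC cD b b'; apply: ub.
Qed.

Lemma no_crossing p q r s P Q S T : uniq [:: p; q; r; s] ->
  cell p P -> cell q Q -> cell r S -> cell s T -> ~ segments_meet P Q S T.
Proof.
move=> u cP cQ cS cT M; have [b|b] := meet_blocked u cP cQ cS cT M.
  by apply: not_blocked cP cQ b; move: u; case: (p); case: (q).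
by apply: not_blocked cS cT b; move: u; case: (r); case: (s);
  rewrite /= ?inE ?eqxx ?andbF.
Qed.

(** This now includes lines of the Fano plane: if their representatives were collinear, the middle
    one would block an edge. *)
Lemma height_neq0_all p q r P Q S : uniq [:: p; q; r] ->
  cell p P -> cell q Q -> cell r S -> height P Q S != 0.
Proof.
rewrite /= !inE negb_or andbT => /andP[/andP[pq pr] qr] cP cQ cS.
have [rE|nr] := eqVneq r (third p q); last first.
  by apply: height_neq0 cP cQ cS; rewrite /triangle pq qr pr nr.
have PQ : P <> Q.
  by move=> e; rewrite e in cP; rewrite (cell_inj cP cQ) eqxx in pq.
apply/eqP=> /(collinear_segment PQ)[h|h|h].
- by apply: (not_blocked pq cP cQ); exists S; rewrite -?rE.
- apply: (not_blocked qr cQ cS); exists P => //.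
  by rewrite rE; move: pq cP; case: (p); case: (q).
- apply: (not_blocked pr cP cS); exists Q => //.
  by rewrite rE; move: pq cQ; case: (p); case: (q).
Qed.

(** Without crossings the triangles over [PQ] with apexes [U], [Z], [W] are nested, but such a chain
    forces a crossing. *)
Lemma no_nested_chain p q x y z P Q U Z W : uniq [:: p; q; x; y; z] ->
  cell p P -> cell q Q -> cell x U -> cell y Z -> cell z W ->
  0 < height P Q Z / height P Q U <= 1 ->
  0 < height P Q W / height P Q Z <= 1 -> False.
Proof.
rewrite /= !inE !negb_or andbT.
move=> /and4P[/and4P[pq px py pz] /and3P[qx qy qz] /andP[xy xz] yz].
move=> cP cQ cU cZ cW h1 h2.
have nested a b A B : a != b -> p != a -> q != a -> p != b -> q != b ->
    cell a A -> cell b B ->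
    0 < height P Q B / height P Q A <= 1 -> below P Q A B.
  move=> ab pa qa pb qb cA cB h.
  have hA : height P Q A != 0.
    by apply: height_neq0_all cP cQ cA; rewrite /= !inE negb_or pq pa qa.
  have [//|M|M] := nested_or_cross hA h.
  - have /no_crossing : uniq [:: p; b; q; a].
      by rewrite /= !inE !negb_or pb pq pa qa [b == q]eq_sym qb [b == a]eq_sym ab.
    by move=> /(_ _ _ _ _ cP cB cQ cA M).
  - have /no_crossing : uniq [:: q; b; p; a].
      by rewrite /= !inE !negb_or qb pa qa [q == p]eq_sym [b == p]eq_sym
        [b == a]eq_sym pq pb ab.
    by move=> /(_ _ _ _ _ cQ cB cP cA M).
have B1 := nested _ _ _ _ xy px qx py qy cU cZ h1.
have B2 := nested _ _ _ _ yz py qy pz qz cZ cW h2.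
have [M|M] := below_chain_meet B1 B2.
- have /no_crossing : uniq [:: x; z; p; y].
    by rewrite /= !inE !negb_or xz xy py [x == p]eq_sym
      [z == p]eq_sym [z == y]eq_sym px pz yz.
  by move=> /(_ _ _ _ _ cU cW cP cZ M).
- have /no_crossing : uniq [:: x; z; q; y].
    by rewrite /= !inE !negb_or xz xy qy [x == q]eq_sym
      [z == q]eq_sym [z == y]eq_sym qx qz yz.
  by move=> /(_ _ _ _ _ cU cW cQ cZ M).
Qed.

Lemma no_three_same_side p q x y z P Q U Z W : uniq [:: p; q; x; y; z] ->
  cell p P -> cell q Q -> cell x U -> cell y Z -> cell z W ->
  0 < height P Q U * height P Q Z -> 0 < height P Q Z * height P Q W -> False.
Proof.
move=> u cP cQ cU cZ cW h1 h2.
have h3 : 0 < height P Q U * height P Q W by nra.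
have chain := no_nested_chain _ cP cQ.
have perm x' y' z' : perm_eq [:: x; y; z] [:: x'; y'; z'] ->
    uniq [:: p; q; x'; y'; z'].
  move=> e; rewrite -(perm_uniq (s1 := [:: p; q] ++ [:: x; y; z])) //.
  by rewrite perm_cat2l.
(* Six of the eight cases sort the heights; the other two are cyclic, and two of their inequalities
   still form a chain. *)
have [k1|k1] := same_sign_ratio h1; have [k2|k2] := same_sign_ratio h2;
  have [k3|k3] := same_sign_ratio h3.
- exact: chain u cU cZ cW k1 k2.
- exact: chain u cU cZ cW k1 k2.
- by apply: chain (perm x z y _) cU cW cZ k3 k2; apply/permP => f /=; lia.
- by apply: chain (perm z x y _) cW cU cZ k3 k1; apply/permP => f /=; lia.
- by apply: chain (perm y x z _) cZ cU cW k1 k3; apply/permP => f /=; lia.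
- by apply: chain (perm y z x _) cZ cW cU k2 k3; apply/permP => f /=; lia.
- by apply: chain (perm z y x _) cW cZ cU k2 k1; apply/permP => f /=; lia.
- by apply: chain (perm z y x _) cW cZ cU k2 k1; apply/permP => f /=; lia.
Qed.

Lemma not_planar : False.
Proof.
have [P cP] := cell_neq0 F1; have [Q cQ] := cell_neq0 F2.
have [A cA] := cell_neq0 F3; have [B cB] := cell_neq0 F4.
have [C cC] := cell_neq0 F5; have [D cD] := cell_neq0 F6.
have [E cE] := cell_neq0 F7.
have side r S : cell r S -> r \notin [:: F1; F2] ->
    height P Q S < 0 \/ 0 < height P Q S.
  move=> cS u; apply/orP; rewrite -neq_lt.
  by apply: height_neq0_all cP cQ cS; move: u; case: (r).
have pos r s t S T U : cell r S -> cell s T -> cell t U ->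
    0 < height P Q S -> 0 < height P Q T -> 0 < height P Q U ->
    uniq [:: F1; F2; r; s; t] -> False.
  move=> cS cT cU hS hT hU u.
  by apply: (no_three_same_side u cP cQ cS cT cU); rewrite mulr_gt0.
have neg r s t S T U : cell r S -> cell s T -> cell t U ->
    height P Q S < 0 -> height P Q T < 0 -> height P Q U < 0 ->
    uniq [:: F1; F2; r; s; t] -> False.
  move=> cS cT cU hS hT hU u.
  by apply: (no_three_same_side u cP cQ cS cT cU); rewrite nmulr_rgt0.
(* Of the five strict signs, three agree. *)
by have [a|a] := side _ _ cA isT; have [b|b] := side _ _ cB isT;
  have [c|c] := side _ _ cC isT; have [d|d] := side _ _ cD isT;
  have [e|e] := side _ _ cE isT;
  match goal with
  | hS : is_true (0 < height P Q ?S), hT : is_true (0 < height P Q ?T),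
    hU : is_true (0 < height P Q ?U), cS : cell _ ?S, cT : cell _ ?T,
    cU : cell _ ?U |- _ => exact: (pos _ _ _ _ _ _ cS cT cU hS hT hU isT)
  | hS : is_true (height P Q ?S < 0), hT : is_true (height P Q ?T < 0),
    hU : is_true (height P Q ?U < 0), cS : cell _ ?S, cT : cell _ ?T,
    cU : cell _ ?U |- _ => exact: (neg _ _ _ _ _ _ cS cT cU hS hT hU isT)
  end.
Qed.

End Plane.

(** * Codewords as points of the Fano plane *)

Section FanoCode.

(** Label [k], of ordinal value [k - 1], becomes the line whose bits are the binary expansion of
    [k]. *)
Definition fano_of_ord (i : 'I_7) : fano :=
  nth F1 [:: F1; F2; F3; F4; F5; F6; F7] i.

Definition ord_of_fano (f : fano) : 'I_7 :=
  match f with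
  | F1 => @Ordinal 7 0 isT | F2 => @Ordinal 7 1 isT | F3 => @Ordinal 7 2 isT
  | F4 => @Ordinal 7 3 isT | F5 => @Ordinal 7 4 isT | F6 => @Ordinal 7 5 isT
  | F7 => @Ordinal 7 6 isT
  end.

Lemma fano_of_ordK : cancel fano_of_ord ord_of_fano.
Proof. by case=> [[|[|[|[|[|[|[|//]]]]]]] i]; apply: val_inj. Qed.

Lemma ord_of_fanoK : cancel ord_of_fano fano_of_ord.
Proof. by case. Qed.

Definition fano_word (n : fano) : {set 'I_7} :=
  [set i | incident n (fano_of_ord i)]%SET.

Lemma fano_wordE n : fano_word n = codeword 7 match n with
  | F1 => [:: 2; 4; 6] | F2 => [:: 1; 4; 5] | F3 => [:: 3; 4; 7]
  | F4 => [:: 1; 2; 3] | F5 => [:: 2; 5; 7] | F6 => [:: 1; 6; 7]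
  | F7 => [:: 3; 5; 6] end.
Proof.
by apply/setP=> -[[|[|[|[|[|[|[|//]]]]]]] i]; rewrite !inE; case: n.
Qed.

Lemma set1_codeword (i : 'I_7) : [set i]%SET = codeword 7 [:: i.+1].
Proof. by apply/setP=> j; rewrite !inE eqSS. Qed.

Lemma fano_codeP (s : {set 'I_7}) : s \in fano_code <->
  [\/ exists n, s = fano_word n, exists i, s = [set i]%SET | s = finset.set0].
Proof.
rewrite inE; split.
  case/mapP=> w ws ->; move: ws; rewrite !inE.
  repeat (case/orP; [move=> /eqP-> | ]); last move=> /eqP->.
  1-7: constructor 1.
  - by exists F4; rewrite fano_wordE.
  - by exists F2; rewrite fano_wordE.
  - by exists F6; rewrite fano_wordE.
  - by exists F1; rewrite fano_wordE.
  - by exists F5; rewrite fano_wordE.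
  - by exists F3; rewrite fano_wordE.
  - by exists F7; rewrite fano_wordE.
  1-7: by constructor 2; match goal with |- context [codeword 7 [:: ?k.+1]] =>
    exists (inord k); rewrite set1_codeword inordK end.
  by constructor 3; apply/setP=> j; rewrite !inE.
case=> [[n ->]|[i ->]|->].
- by rewrite fano_wordE; apply: map_f; case: n.
- rewrite set1_codeword; apply: map_f.
  by case: i => [[|[|[|[|[|[|[|//]]]]]]] i].
- have -> : finset.set0 = codeword 7 [::] by apply/setP=> j; rewrite !inE.
  exact: map_f.
Qed.

End FanoCode.

(** * Convexity, and realizations in dimension at most two *)

Section Realizations.
Import Order.TTheory GRing.Theory Num.Theory.
Local Open Scope ring_scope.
Variable R : realType.

Lemma convex_setP n (A : set 'rV[R]_n) : convex_set A <->
  forall x y (a b : R), A x -> A y -> 0 <= a -> 0 <= b -> a + b = 1 ->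
    A (a *: x + b *: y).
Proof.
split=> [cA x y a b Ax Ay a0 b0 ab|cA x y l].
  have a1 : a <= 1 by lra.
  have := cA x y (Itv01 a0 a1) (mem_set Ax) (mem_set Ay).
  move/set_mem; suff -> : b = 1 - a by []; lra.
move=> /set_mem Ax /set_mem Ay; apply/mem_set; apply: cA => //.
- by rewrite subr_ge0.
- by rewrite addrC subrK.
Qed.

Lemma fano_code_not_planar (X : 'I_7 -> set 'rV[R]_2) :
  (forall i, convex_set (X i)) -> ~ realizes X fano_code.
Proof.
move=> cX rX; apply: (@not_planar R (X \o ord_of_fano)).
- move=> l P Q Z XP XQ [a [b [a0 b0 ab ->]]].
  by have /convex_setP := cX (ord_of_fano l); apply.
- move=> l m Z lm Xl Xm.
  pose s := [set i | `[< X i Z >]]%SET.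
  have sE i : X i Z <-> i \in s by rewrite inE; split=> /asboolP.
  (* [Z] lies in two of the sets, so its word is neither a singleton nor empty. *)
  have /fano_codeP[[n sn]|[i si]|s0] : s \in fano_code by apply/rX; exists Z.
  + exists n => k; rewrite -{2}(ord_of_fanoK k).
    by have := sE (ord_of_fano k); rewrite sn inE.
  + move: lm; have /sE := Xl; have /sE := Xm; rewrite si !inE.
    move=> /eqP e1 /eqP e2.
    by rewrite -(ord_of_fanoK l) -(ord_of_fanoK m) e1 e2 eqxx.
  + by have /sE := Xl; rewrite s0 inE.
- move=> n; have /rX[Z ZE] : fano_word n \in fano_code.
    by apply/fano_codeP; constructor 1; exists n.
  by exists Z => l; rewrite /= ZE inE ord_of_fanoK.
Qed.

(** Preimages under a surjective linear map from the plane keep both convexity and the code. *)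
Lemma fano_code_dim_gt2 d : (d <= 2)%N ->
  ~ closed_convex_realizable R d fano_code.
Proof.
move=> d2 [X [_ cX rX]].
pose f (p : 'rV[R]_2) : 'rV[R]_d := p *m pid_mx d.
have fK (q : 'rV[R]_d) : f (q *m pid_mx d) = q.
  by rewrite /f -mulmxA mul_pid_mx minnn (minn_idPr d2) pid_mx_1 mulmx1.
apply: (@fano_code_not_planar (fun i => X i \o f)).
  move=> i; apply/convex_setP => x y a b Xx Xy a0 b0 ab.
  rewrite /comp /f mulmxDl -!scalemxAl.
  by have /convex_setP := cX i; apply.
move=> s; split=> [/rX[q qE]|[p pE]].
  by exists (q *m pid_mx d) => i; rewrite /= fK.
by apply/rX; exists (f p).
Qed.

End Realizations.

(** * Dimension three *)

Section Space.
Import Order.TTheory GRing.Theory Num.Theory.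
Local Open Scope ring_scope.
Variable R : realType.

(* The tuple (a, b, c, d) stands for the half-space a x + b y + c z <= d. *)
Definition polyhedron (cs : seq (R * R * R * R)) (x y z : R) : bool :=
  all (fun '(a, b, c, d) => a * x + b * y + c * z <= d) cs.

Definition coord3 (p : 'rV[R]_3) (k : nat) : R := p 0 (inord k).

Definition polyhedron_set cs : set 'rV[R]_3 :=
  [set p | polyhedron cs (coord3 p 0) (coord3 p 1) (coord3 p 2)].

Lemma closed_polyhedron cs : closed (polyhedron_set cs).
Proof.
elim: cs => [|[[[a b] c] d] cs IH].
  by rewrite (_ : polyhedron_set _ = setT); [exact: closedT | exact/seteqP].
rewrite (_ : polyhedron_set _ =
  (fun p => a * coord3 p 0 + b * coord3 p 1 + c * coord3 p 2) @^-1`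
    [set t | t <= d] `&` polyhedron_set cs)%classic; last first.
  by apply/seteqP; split=> p => [/andP[]|[? ?]] //; apply/andP.
apply: closedI => //; apply: (preimage_closed _ (@closed_le _ d)).
have cont (k : nat) (e : R) : continuous (fun p => e * coord3 p k).
  move=> p; have h := @coord_continuous R 1 3 0 (inord k) p.
  exact: (cvgM (cvg_cst e) h).
by move=> p _; exact: (cvgD (cvgD (cont 0 a p) (cont 1 b p)) (cont 2 c p)).
Qed.

Lemma convex_polyhedron cs : convex_set (polyhedron_set cs).
Proof.
apply/convex_setP => p q s t; elim: cs => [//|[[[a b] c] d] cs IH] /=.
move=> /andP[hp csp] /andP[hq csq] s0 t0 st.
apply/andP; split; last exact: IH.
rewrite /coord3 !mxE in hp hq *.
have : s * (a * p 0 (inord 0) + b * p 0 (inord 1) + c * p 0 (inord 2)) +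
  t * (a * q 0 (inord 0) + b * q 0 (inord 1) + c * q 0 (inord 2)) <= s * d + t * d.
  by rewrite lerD // ler_wpM2l.
rewrite -mulrDl st mul1r; apply: le_trans; rewrite le_eqVlt; apply/orP; left.
by apply/eqP; ring.
Qed.

(** The coordinates are chosen so that two of the seven triangles meet only in their common vertex,
    as [facets_meet] checks. *)
Definition vertex (n : fano) : R * R * R :=
  match n with
  | F1 => (0, 2, 0) | F2 => (0, 0, 0) | F3 => (1, 0, 2) | F4 => (1, 2, 1)
  | F5 => (0, 0, 3) | F6 => (2, 3, 0) | F7 => (0, 1, 1)
  end.

(* [facets l] cuts out the triangle whose vertices are the [vertex n] for [n]
   incident with [l]: its plane, as two half-spaces, and one half-space per
   side. *)
Definition facets (l : fano) : seq (R * R * R * R) :=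
  match l with
  | F1 => [:: (3, -2, 1, 0); (-3, 2, -1, 0); (-1, 0, 1, 0); (0, 0, -1, 0);
              (-1, 1, 0, 1)]
  | F2 => [:: (-2, 3, 2, 6); (2, -3, -2, -6); (0, 1, 0, 2); (-1, 0, 0, 0);
              (0, 1, 1, 3)]
  | F3 => [:: (1, -1, -2, -3); (-1, 1, 2, 3); (1, 0, 0, 1); (-1, -1, 0, -1);
              (0, 0, -1, -1)]
  | F4 => [:: (2, 0, -1, 0); (-2, 0, 1, 0); (-1, 0, 0, 0); (0, 1, 1, 2);
              (0, -1, 0, 0)]
  | F5 => [:: (-1, 0, 0, 0); (1, 0, 0, 0); (0, -1, 0, 0); (0, 2, 1, 3);
              (0, 1, -1, 0)]
  | F6 => [:: (-1, 2, 2, 4); (1, -2, -2, -4); (0, 0, -1, 0); (-1, 0, 0, 0);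
              (1, -1, 0, -1)]
  | F7 => [:: (3, 1, 3, 9); (-3, -1, -3, -9); (0, 1, 1, 3); (0, -1, 0, 0);
              (1, -1, -1, -1)]
  end.

(* Three times the centroid of the triangle cut out by [facets l]. *)
Definition centroid3 (l : fano) : R * R * R :=
  match l with
  | F1 => (3, 5, 1) | F2 => (1, 4, 4) | F3 => (2, 3, 4) | F4 => (1, 2, 2)
  | F5 => (0, 1, 4) | F6 => (2, 6, 1) | F7 => (3, 3, 5)
  end.

Let in_polyhedron l (v : R * R * R) := polyhedron (facets l) v.1.1 v.1.2 v.2.

Lemma vertex_facets n l : in_polyhedron l (vertex n) = incident n l.
Proof.
rewrite /in_polyhedron /polyhedron.
case: l; case: n; rewrite /=; apply/idP/idP => //.
all: solve [repeat (apply/andP; split); (done || lra)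
  | apply/negP => /andP[h1] /andP[h2] /andP[h3] /andP[h4] /andP[h5] _; lra].
Qed.

(** The centroids realize the singleton words. *)
Lemma centroid_facets l m :
  polyhedron (facets m) ((centroid3 l).1.1 / 3) ((centroid3 l).1.2 / 3)
    ((centroid3 l).2 / 3) = (l == m).
Proof.
rewrite /polyhedron.
case: l; case: m; rewrite /=; apply/idP/idP => //.
all: solve [repeat (apply/andP; split); (done || lra)
  | apply/negP => /andP[h1] /andP[h2] /andP[h3] /andP[h4] /andP[h5] _; lra].
Qed.

(** This point realizes the empty word. *)
Lemma facets_outside l : polyhedron (facets l) 10 10 10 = false.
Proof.
apply/negP; rewrite /polyhedron; case: l => /=.
all: by move=> /andP[h1] /andP[h2] /andP[h3] /andP[h4] /andP[h5] _; lra.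
Qed.

Lemma facets_meet l m x y z : l != m ->
  polyhedron (facets l) x y z -> polyhedron (facets m) x y z ->
  (x, y, z) = vertex (join l m).
Proof.
rewrite /polyhedron; case: l; case: m => // _ /=.
all: move=> /andP[a1] /andP[a2] /andP[a3] /andP[a4] /andP[a5] _.
all: move=> /andP[b1] /andP[b2] /andP[b3] /andP[b4] /andP[b5] _.
all: congr (_, _, _); lra.
Qed.

Lemma fano_code_space : closed_convex_realizable R 3 fano_code.
Proof.
exists (fun i => polyhedron_set (facets (fano_of_ord i))); split.
- by move=> i; exact: closed_polyhedron.
- by move=> i; exact: convex_polyhedron.
pose pt (v : R * R * R) : 'rV[R]_3 := \row_j nth 0 [:: v.1.1; v.1.2; v.2] j.
have ptE v i : polyhedron_set (facets (fano_of_ord i)) (pt v) <->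
    polyhedron (facets (fano_of_ord i)) v.1.1 v.1.2 v.2.
  by rewrite /polyhedron_set /coord3 /= !mxE !inordK.
move=> s; split=> [/fano_codeP[[n ->]|[i ->]|->]|[p pE]].
- exists (pt (vertex n)) => i; rewrite inE -vertex_facets; exact: ptE.
- pose c := centroid3 (fano_of_ord i).
  exists (pt (c.1.1 / 3, c.1.2 / 3, c.2 / 3)) => j.
  by rewrite inE eq_sym -(can_eq fano_of_ordK) -centroid_facets; exact: ptE.
- exists (pt (10, 10, 10)) => i; rewrite inE -(facets_outside (fano_of_ord i)).
  exact: ptE.
apply/fano_codeP; have [->|[i is_]] := set_0Vmem s; first by constructor 3.
have [->|si] := eqVneq s [set i]%SET; first by constructor 2; exists i.
have [j js ij] : exists2 j, j \in s & j != i.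
  have : ~~ (s \subset [set i]%SET).
    by apply: contra si => ss; rewrite finset.eqEsubset ss finset.sub1set.
  by case/subsetPn => j js; rewrite inE; exists j.
(* Two labels pin the point down to a vertex, and the vertex determines the whole word. *)
constructor 1; exists (join (fano_of_ord j) (fano_of_ord i)).
have ji : fano_of_ord j != fano_of_ord i by rewrite (can_eq fano_of_ordK).
have e := facets_meet ji ((pE j).2 js) ((pE i).2 is_).
apply/setP=> k; rewrite inE -vertex_facets -e.
by apply/idP/idP => [/pE|h]; last apply/pE.
Qed.

End Space.

Theorem theorem3p1 (R : realType) :
  ~ (exists X : 'I_7 -> set 'rV[R]_2,
       [/\ forall i, closed (X i), forall i, convex_set (X i)
         & realizes X fano_code])
  /\ cdim R fano_code = Some 3.
Proof.
split; first by case=> X [_ cX rX]; exact: (fano_code_not_planar cX rX).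
have space := asboolT (fano_code_space R).
rewrite /cdim; case: pselect => [exd|]; last by case; exists 3.
congr Some; case: ex_minnP => d /asboolP dr dmin.
apply/eqP; rewrite eqn_leq dmin //= ltnNge.
by apply/negP => d2; exact: (fano_code_dim_gt2 d2 dr).
Qed.
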